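(* Let $K$ be a bounded right linear operator (whose range need not be closed) on a separable right quaternionic Hilbert space $\mathbb{H}(\mathfrak{H})$, and let $\{f_k\}_{k\in I}$ be a $K$-frame for $\mathbb{H}(\mathfrak{H})$ with synthesis operator $T_F$. Let $\{e_k\}_{k\in I}$ be the standard orthonormal basis of $\ell^2(\mathfrak{H})$. Then a sequence $\{g_k\}_{k\in I}$ in $\mathbb{H}(\mathfrak{H})$ is a $K$-dual of $\{f_k\}_{k\in I}$ if and only if there exists a bounded right linear operator $M:\ell^2(\mathfrak{H})\to\mathbb{H}(\mathfrak{H})$ such that $T_FM^*=K$ and $$g_k=Me_k,\qquad k\in I.$$
   Context: $\mathfrak{H}$ denotes the quaternions. A right quaternionic Hilbert space $\mathbb{H}(\mathfrak{H})$ is a right $\mathfrak{H}$-vector space with an inner product $\langle\cdot,\cdot\rangle$ valued in $\mathfrak{H}$ that satisfies $\overline{\langle x,y\rangle}=\langle y,x\rangle$, $\langle x,x\rangle>0$ for $x\neq0$, additivity in the second argument, and $\langle x,yq\rangle=\langle x,y\rangle q$ for $q\in\mathfrak{H}$, and it is complete for $\|x\|=\sqrt{\langle x,x\rangle}$. $I$ is a countable index set. $\ell^2(\mathfrak{H})$ is the right quaternionic Hilbert space of square-summable families $\{q_k\}_{k\in I}\subset\mathfrak{H}$ with $\langle p,q\rangle=\sum_{k}\overline{p_k}q_k$. All operators are bounded and right linear ($T(xp+yq)=T(x)p+T(y)q$), and $T^*$ is the adjoint. A family $\{f_k\}_{k\in I}\subset\mathbb{H}(\mathfrak{H})$ is a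 Bessel sequence if there is $B>0$ with $\sum_{k}|\langle x,f_k\rangle|^2\le B\|x\|^2$ for all $x$. It is a $K$-frame if there are $A,B>0$ with $A\|K^*x\|^2\le\sum_{k}|\langle x,f_k\rangle|^2\le B\|x\|^2$ for all $x$. A Bessel sequence $\{g_k\}_{k\in I}$ is a $K$-dual of a $K$-frame $\{f_k\}_{k\in I}$ if $Kx=\sum_{k\in I}f_k\langle g_k,x\rangle$ for all $x\in\mathbb{H}(\mathfrak{H})$. The synthesis operator of a Bessel sequence $F=\{f_k\}$ is $T_F:\ell^2(\mathfrak{H})\to\mathbb{H}(\mathfrak{H})$, $T_F(\{c_k\})=\sum_kf_kc_k$, with adjoint $T_F^*x=\{\langle f_k,x\rangle\}_{k}$. *)

(* Defs.v *)
From HB Require Import structures.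
From mathcomp Require Import all_boot all_order all_algebra finmap.
From mathcomp Require Import ring lra.
From mathcomp Require Import mathcomp_extra boolp classical_sets functions.
From mathcomp Require Import cardinality fsbigop reals ereal.
From mathcomp Require Import summability topology normedtype sequences esum.

Set Implicit Arguments.
Unset Strict Implicit.
Unset Printing Implicit Defensive.

Import Order.TTheory GRing.Theory Num.Theory.
Import numFieldNormedType.Exports.

Local Open Scope classical_set_scope.
Local Open Scope ring_scope.

#[global] Existing Instance totally_filter.

(* Quat a b c d is a + b i + c j + d k *)
Record quat (R : Type) := Quat { qre : R; qi : R; qj : R; qk : R }.
Arguments Quat {R}.

Section quat_encode.
Variable R : Type.
Definition quat_enc (q : quat R) := (qre q, qi q, qj q, qk q).
Definition quat_dec (t : R * R * R * R) :=
  let: (a, b, c, d) := t in Quat a b c d.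
Lemma quat_encK : cancel quat_enc quat_dec. Proof. by case. Qed.
End quat_encode.

HB.instance Definition _ (R : eqType) := Equality.copy (quat R) (can_type (@quat_encK R)).
HB.instance Definition _ (R : choiceType) := Choice.copy (quat R) (can_type (@quat_encK R)).

Section quat_ring.
Variable R : realType.
Implicit Types p q r : quat R.

Definition qadd p q :=
  Quat (qre p + qre q) (qi p + qi q) (qj p + qj q) (qk p + qk q).
Definition qopp q := Quat (- qre q) (- qi q) (- qj q) (- qk q).
Definition qmul p q :=
  Quat (qre p * qre q - qi p * qi q - qj p * qj q - qk p * qk q)
       (qre p * qi q + qi p * qre q + qj p * qk q - qk p * qj q)
       (qre p * qj q - qi p * qk q + qj p * qre q + qk p * qi q)
       (qre p * qk q + qi p * qj q - qj p * qi q + qk p * qre q).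

Lemma qaddA : associative qadd.
Proof. by move=> p q r; rewrite /qadd /= !addrA. Qed.
Lemma qaddC : commutative qadd.
Proof. by move=> p q; congr Quat; rewrite addrC. Qed.
Lemma qadd0 : left_id (Quat 0 0 0 0) qadd.
Proof. by case=> a b c d; rewrite /qadd /= !add0r. Qed.
Lemma qaddN : left_inverse (Quat 0 0 0 0) qopp qadd.
Proof. by case=> a b c d; rewrite /qadd /= !addNr. Qed.
HB.instance Definition _ := GRing.isZmodule.Build (quat R) qaddA qaddC qadd0 qaddN.

Lemma qmulA : associative qmul.
Proof. by move=> p q r; congr Quat => /=; ring. Qed.
Lemma qmul1q : left_id (Quat 1 0 0 0) qmul.
Proof. by case=> a b c d; congr Quat => /=; ring. Qed.
Lemma qmulq1 : right_id (Quat 1 0 0 0) qmul.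
Proof. by case=> a b c d; congr Quat => /=; ring. Qed.
Lemma qmulDl : left_distributive qmul (fun p q => p + q).
Proof. by move=> p q r; congr Quat => /=; ring. Qed.
Lemma qmulDr : right_distributive qmul (fun p q => p + q).
Proof. by move=> p q r; congr Quat => /=; ring. Qed.
Lemma quat1_neq0 : Quat 1 0 0 0 != 0 :> quat R.
Proof. by apply/eqP => -[/eqP]; rewrite oner_eq0. Qed.
HB.instance Definition _ := GRing.Zmodule_isNzRing.Build (quat R)
  qmulA qmul1q qmulq1 qmulDl qmulDr quat1_neq0.

Definition qconj q := Quat (qre q) (- qi q) (- qj q) (- qk q).
Definition qabs q : R :=
  Num.sqrt (qre q ^+ 2 + qi q ^+ 2 + qj q ^+ 2 + qk q ^+ 2).

Lemma qabs_sqr q :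
  qabs q ^+ 2 = qre q ^+ 2 + qi q ^+ 2 + qj q ^+ 2 + qk q ^+ 2.
Proof. by rewrite sqr_sqrtr // !addr_ge0 // sqr_ge0. Qed.

Lemma qabs_ge0 q : 0 <= qabs q. Proof. exact: sqrtr_ge0. Qed.

Lemma qabsD p q : qabs (p + q) <= qabs p + qabs q.
Proof.
rewrite -(@ler_pXn2r _ 2) ?nnegrE ?addr_ge0 ?qabs_ge0 //.
rewrite sqrrD !qabs_sqr /=.
set u := qre p * qre q + qi p * qi q + qj p * qj q + qk p * qk q.
suff uP : u <= qabs p * qabs q by rewrite /u in uP; lra.
apply: le_trans (ler_norm _) _.
rewrite -(@ler_pXn2r _ 2) ?nnegrE ?mulr_ge0 ?qabs_ge0 //.
rewrite real_normK ?num_real // exprMn !qabs_sqr -subr_ge0.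
set v := (X in 0 <= X).
have -> : v = (qre p * qi q - qi p * qre q) ^+ 2
   + (qre p * qj q - qj p * qre q) ^+ 2 + (qre p * qk q - qk p * qre q) ^+ 2
   + (qi p * qj q - qj p * qi q) ^+ 2 + (qi p * qk q - qk p * qi q) ^+ 2
   + (qj p * qk q - qk p * qj q) ^+ 2 by rewrite /v /u; ring.
by rewrite !addr_ge0 // sqr_ge0.
Qed.

Lemma qabs0_eq0 q : qabs q = 0 -> q = 0.
Proof.
move=> q0; have := qabs_sqr q; rewrite q0 expr0n /= => /esym/eqP.
rewrite !paddr_eq0 ?addr_ge0 ?sqr_ge0 // !sqrf_eq0.
by case: q {q0} => a b c d /= /andP[/andP[/andP[/eqP-> /eqP->] /eqP->] /eqP->].
Qed.

Lemma qre_is_zmod : zmod_morphism (@qre R). Proof. by []. Qed.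
Lemma qi_is_zmod : zmod_morphism (@qi R). Proof. by []. Qed.
Lemma qj_is_zmod : zmod_morphism (@qj R). Proof. by []. Qed.
Lemma qk_is_zmod : zmod_morphism (@qk R). Proof. by []. Qed.
Lemma qconj_is_zmod : zmod_morphism qconj.
Proof. by move=> p q; congr Quat; rewrite /= opprD. Qed.
HB.instance Definition _ := GRing.isZmodMorphism.Build _ _ (@qre R) qre_is_zmod.
HB.instance Definition _ := GRing.isZmodMorphism.Build _ _ (@qi R) qi_is_zmod.
HB.instance Definition _ := GRing.isZmodMorphism.Build _ _ (@qj R) qj_is_zmod.
HB.instance Definition _ := GRing.isZmodMorphism.Build _ _ (@qk R) qk_is_zmod.
HB.instance Definition _ := GRing.isZmodMorphism.Build _ _ qconj qconj_is_zmod.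

Lemma qabsMn q n : qabs (q *+ n) = qabs q *+ n.
Proof.
apply/eqP; rewrite -(@eqrXn2 _ 2) ?qabs_ge0 ?mulrn_wge0 ?qabs_ge0 //; apply/eqP.
by rewrite exprMn_n !qabs_sqr !raddfMn /= !exprMn_n !mulrnDl.
Qed.

Lemma qabsN q : qabs (- q) = qabs q.
Proof. by rewrite /qabs /= !sqrrN. Qed.

HB.instance Definition _ := Num.Zmodule_isNormed.Build R (quat R)
  qabsD qabs0_eq0 qabsMn qabsN.
HB.instance Definition _ := PseudoMetric.copy (quat R) (pseudoMetric_normed (quat R)).
HB.instance Definition _ := isPointed.Build (quat R) 0.
HB.instance Definition _ := NormedZmod_PseudoMetric_eq.Build R (quat R) erefl.

Lemma qnormE q : `|q| = qabs q. Proof. by []. Qed.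
Lemma qnorm_sqr q :
  `|q| ^+ 2 = qre q ^+ 2 + qi q ^+ 2 + qj q ^+ 2 + qk q ^+ 2.
Proof. exact: qabs_sqr. Qed.

Lemma qconjK q : qconj (qconj q) = q.
Proof. by case: q => a b c d; congr Quat; rewrite opprK. Qed.
Lemma qconjM p q : qconj (p * q) = qconj q * qconj p.
Proof. by congr Quat => /=; ring. Qed.
Lemma qmul_conj_self q : qconj q * q = Quat (`|q| ^+ 2) 0 0 0.
Proof. by rewrite qnorm_sqr; congr Quat => /=; ring. Qed.
Lemma qnorm_conj q : `|qconj q| = `|q|.
Proof. by rewrite !qnormE /qabs /= !sqrrN. Qed.
Lemma qnormM p q : `|p * q| = `|p| * `|q|.
Proof.
apply/eqP; rewrite -(@eqrXn2 _ 2) ?mulr_ge0 //; apply/eqP.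
by rewrite exprMn !qnorm_sqr /=; ring.
Qed.

Lemma qre_le q : `|qre q| <= `|q|.
Proof.
rewrite -(@ler_pXn2r _ 2) ?nnegrE // qnorm_sqr real_normK ?num_real //.
by have := sqr_ge0 (qi q); have := sqr_ge0 (qj q); have := sqr_ge0 (qk q); lra.
Qed.
Lemma qi_le q : `|qi q| <= `|q|.
Proof.
rewrite -(@ler_pXn2r _ 2) ?nnegrE // qnorm_sqr real_normK ?num_real //.
by have := sqr_ge0 (qre q); have := sqr_ge0 (qj q); have := sqr_ge0 (qk q); lra.
Qed.
Lemma qj_le q : `|qj q| <= `|q|.
Proof.
rewrite -(@ler_pXn2r _ 2) ?nnegrE // qnorm_sqr real_normK ?num_real //.
by have := sqr_ge0 (qi q); have := sqr_ge0 (qre q); have := sqr_ge0 (qk q); lra.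
Qed.
Lemma qk_le q : `|qk q| <= `|q|.
Proof.
rewrite -(@ler_pXn2r _ 2) ?nnegrE // qnorm_sqr real_normK ?num_real //.
by have := sqr_ge0 (qi q); have := sqr_ge0 (qj q); have := sqr_ge0 (qre q); lra.
Qed.
Lemma qnorm_le q : `|q| <= `|qre q| + `|qi q| + `|qj q| + `|qk q|.
Proof.
rewrite -(@ler_pXn2r _ 2) ?nnegrE ?addr_ge0 // qnorm_sqr.
rewrite -[qre q ^+ 2]real_normK ?num_real // -[qi q ^+ 2]real_normK ?num_real //.
rewrite -[qj q ^+ 2]real_normK ?num_real // -[qk q ^+ 2]real_normK ?num_real //.
have := normr_ge0 (qre q); have := normr_ge0 (qi q).
have := normr_ge0 (qj q); have := normr_ge0 (qk q); nra.
Qed.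

End quat_ring.

Section lipschitz.
Context {R : realType} {U V : pseudoMetricNormedZmodType R}.
Variables (h : {additive U -> V}) (C : R).
Hypothesis hle : forall x, `|h x| <= C * `|x|.

Let C1 : 0 < `|C| + 1. Proof. by rewrite ltr_wpDl. Qed.
Let hlt x e : 0 < e -> `|x| < e / (`|C| + 1) -> `|h x| < e.
Proof.
move=> e0; rewrite ltr_pdivlMr // => xe; apply: le_lt_trans (hle x) _.
apply: le_lt_trans xe; rewrite mulrC ler_wpM2l //.
by rewrite (le_trans (ler_norm _)) // lerDl.
Qed.

Lemma lipschitz_cauchy (F : set_system U) : ProperFilter F -> cauchy F ->
  cauchy (h @ F).
Proof.
move=> FF /cauchyP Fc; apply/cauchyP => e e0.
have [x Fx] := Fc _ (divr_gt0 e0 C1); exists (h x); rewrite /nbhs /=.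
apply: filterS Fx => y; rewrite -!ball_normE /= => xy.
by rewrite -raddfB hlt.
Qed.

Lemma lipschitz_additive_continuous : continuous h.
Proof.
move=> x; apply/cvgrPdist_lt => e e0; near=> y.
rewrite -raddfB hlt //; near: y.
by apply: cvgr_dist_lt => //; rewrite divr_gt0.
Unshelve. all: by end_near. Qed.
End lipschitz.

Section quat_complete.
Variable R : realType.

Lemma quat_complete (F : set_system (quat R)) :
  ProperFilter F -> cauchy F -> cvg F.
Proof.
move=> FF Fc.
have lc (h : {additive quat R -> R}) : (forall q, `|h q| <= `|q|) ->
    exists l : R, forall e, 0 < e -> \forall q \near F, `|l - h q| < e.
  move=> hle; have h1 q : `|h q| <= 1 * `|q| by rewrite mul1r.
  have /cauchy_cvg/cvg_ex[l hl] := lipschitz_cauchy h1 FF Fc.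
  by exists l; move/cvgrPdist_lt: hl.
have [a ha] := lc _ (@qre_le R); have [b hb] := lc _ (@qi_le R).
have [c hc] := lc _ (@qj_le R); have [d hd] := lc _ (@qk_le R).
apply/cvg_ex; exists (Quat a b c d).
apply/cvgrPdist_lt => e e0; have e40 : 0 < e / 4 by lra.
near=> q; apply: le_lt_trans (qnorm_le _) _ => /=.
have h1 : `|a - qre q| < e / 4 by near: q; exact: ha.
have h2 : `|b - qi q| < e / 4 by near: q; exact: hb.
have h3 : `|c - qj q| < e / 4 by near: q; exact: hc.
have h4 : `|d - qk q| < e / 4 by near: q; exact: hd.
lra.
Unshelve. all: by end_near. Qed.

HB.instance Definition _ := Uniform_isComplete.Build (quat R) quat_complete.

End quat_complete.

HB.mixin Record Zmodule_isQuatRModule (R : realType) V & GRing.Zmodule V := {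
  rscale : V -> quat R -> V;
  rscaleA : forall x a b, rscale (rscale x a) b = rscale x (a * b);
  rscale1 : forall x, rscale x 1 = x;
  rscaleDl : forall x y a, rscale (x + y) a = rscale x a + rscale y a;
  rscaleDr : forall x a b, rscale x (a + b) = rscale x a + rscale x b
}.

#[short(type="quatRmodType")]
HB.structure Definition QuatRModule (R : realType) :=
  {V of GRing.Zmodule V & Zmodule_isQuatRModule R V}.

Notation "x *> a" := (rscale x a) (at level 40, left associativity) : ring_scope.

(* Since qdot x x is fixed by conjugation it is real, so that qdot_gt0 is the
   positivity of the quaternion qdot x x. *)
HB.mixin Record isQuatPreHilbert (R : realType) V
    & QuatRModule R V & PseudoMetricNormedZmod R V := {
  qdot : V -> V -> quat R;
  qdotC : forall x y, qconj (qdot x y) = qdot y x;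
  qdot_gt0 : forall x, x != 0 -> 0 < qre (qdot x x);
  qdotDr : forall x y z, qdot x (y + z) = qdot x y + qdot x z;
  qdotZr : forall x y a, qdot x (y *> a) = qdot x y * a;
  qdot_norm : forall x, `|x| = Num.sqrt (qre (qdot x x))
}.

#[short(type="quatPreHilbertType")]
HB.structure Definition QuatPreHilbert (R : realType) :=
  {V of QuatRModule R V & PseudoMetricNormedZmod R V & isQuatPreHilbert R V}.

(* The field repeats that of Uniform_isComplete: the structure Complete has no
   join with the other ones here, because of CompleteNormedModule. *)
HB.mixin Record QuatPreHilbert_isComplete (R : realType) V
    & QuatPreHilbert R V := {
  quat_cauchy_cvg : forall F : set_system V, ProperFilter F -> cauchy F -> cvg F
}.

#[short(type="quatHilbertType")]
HB.structure Definition QuatHilbert (R : realType) :=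
  {V of QuatPreHilbert R V & QuatPreHilbert_isComplete R V}.

HB.factory Record QuatRModule_hasDot (R : realType) V
    & QuatRModule R V := {
  dot : V -> V -> quat R;
  dotC : forall x y, qconj (dot x y) = dot y x;
  dot_gt0 : forall x, x != 0 -> 0 < qre (dot x x);
  dotDr : forall x y z, dot x (y + z) = dot x y + dot x z;
  dotZr : forall x y a, dot x (y *> a) = dot x y * a;
}.

HB.builders Context R V & QuatRModule_hasDot R V.

Let nrm (x : V) : R := Num.sqrt (qre (dot x x)).

Let dot0r x : dot x 0 = 0.
Proof. by apply: (addrI (dot x 0)); rewrite -dotDr !addr0. Qed.

Let dotDl x y z : dot (x + y) z = dot x z + dot y z.
Proof. by rewrite -dotC dotDr raddfD /= !dotC. Qed.

Let dotZl x y a : dot (x *> a) y = qconj a * dot x y.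
Proof. by rewrite -dotC dotZr qconjM dotC. Qed.

Let redot_ge0 x : 0 <= qre (dot x x).
Proof.
by have [->|/dot_gt0/ltW//] := eqVneq x 0; rewrite dot0r.
Qed.

Let nrm_sqr x : nrm x ^+ 2 = qre (dot x x).
Proof. by rewrite sqr_sqrtr. Qed.

Let nrm_ge0 x : 0 <= nrm x. Proof. exact: sqrtr_ge0. Qed.

Let nrm0_eq0 x : nrm x = 0 -> x = 0.
Proof.
move=> x0; apply/eqP; apply: contraT => /dot_gt0.
by rewrite -nrm_sqr x0 expr0n ltxx.
Qed.

Let redotC x y : qre (dot y x) = qre (dot x y).
Proof. by rewrite -dotC. Qed.

Let redot_le x y : qre (dot x y) <= nrm x * nrm y.
Proof.
have quad (t : R) : 0 <= nrm x ^+ 2 + t *+ 2 * qre (dot x y) + t ^+ 2 * nrm y ^+ 2.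
  have := redot_ge0 (x + y *> Quat t 0 0 0).
  rewrite dotDl !dotDr !dotZl !dotZr !raddfD /= -!nrm_sqr.
  by rewrite (redotC x y) !nrm_sqr; lra.
have [y0|y0] := eqVneq (nrm y) 0.
  by rewrite y0 mulr0 (nrm0_eq0 y0) dot0r.
have yp : 0 < nrm y by rewrite lt_def y0 /=.
have := nrm_ge0 x; set a := nrm x in quad *; set b := nrm y in quad yp y0 *.
move=> a0; have := quad (- a / b).
have -> : (- a / b) ^+ 2 * b ^+ 2 = a ^+ 2.
  by rewrite exprMn mulrAC -mulrA exprVn; field.
set c := qre _ => h.
have [a00|ap] := eqVneq a 0.
  rewrite a00 mul0r.
  have := quad ((- c) / b ^+ 2); rewrite a00 -/c => {h}h.
  have e : 0 ^+ 2 + (- c / b ^+ 2) *+ 2 * c + (- c / b ^+ 2) ^+ 2 * b ^+ 2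
     = - (c ^+ 2 / b ^+ 2) by field.
  move: h; rewrite e oppr_ge0 pmulr_lle0 ?invr_gt0 ?exprn_gt0 // => c2.
  have /eqP : c ^+ 2 == 0 by rewrite eq_le c2 sqr_ge0.
  by move=> /eqP; rewrite sqrf_eq0 => /eqP ->.
have {}ap : 0 < a by rewrite lt_def ap.
have e : a ^+ 2 + (- a / b) *+ 2 * c + a ^+ 2 = (a / b) *+ 2 * (a * b - c).
  by field.
move: h; rewrite e pmulr_rge0 ?subr_ge0 //.
by rewrite pmulrn_lgt0 // divr_gt0.
Qed.

Let nrmD x y : nrm (x + y) <= nrm x + nrm y.
Proof.
rewrite -(@ler_pXn2r _ 2) ?nnegrE ?addr_ge0 // sqrrD !nrm_sqr.
rewrite dotDl !dotDr !raddfD /= (redotC x y); have := redot_le x y; lra.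
Qed.

Let nrmMn x n : nrm (x *+ n) = nrm x *+ n.
Proof.
have dotMnr (a b : V) : dot a (b *+ n) = dot a b *+ n.
  by elim: n => [|n IH]; rewrite ?mulr0n ?dot0r // !mulrS dotDr IH.
have dotMnl (a b : V) : dot (a *+ n) b = dot a b *+ n.
  by rewrite -dotC dotMnr raddfMn /= dotC.
apply/eqP; rewrite -(@eqrXn2 _ 2) ?mulrn_wge0 //; apply/eqP.
by rewrite exprMn_n !nrm_sqr dotMnr dotMnl !raddfMn /= -mulrnA.
Qed.

Let nrmN x : nrm (- x) = nrm x.
Proof.
have dotNr (a b : V) : dot a (- b) = - dot a b.
  by apply: (addrI (dot a b)); rewrite -dotDr !subrr dot0r.
have dotNl (a b : V) : dot (- a) b = - dot a b.
  by rewrite -dotC dotNr raddfN /= dotC.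
by rewrite /nrm dotNr dotNl opprK.
Qed.

HB.instance Definition _ := Num.Zmodule_isNormed.Build R V
  nrmD nrm0_eq0 nrmMn nrmN.
HB.instance Definition _ := PseudoMetric.copy V (pseudoMetric_normed V).
HB.instance Definition _ := isPointed.Build V 0.
HB.instance Definition _ := NormedZmod_PseudoMetric_eq.Build R V erefl.
HB.instance Definition _ := isQuatPreHilbert.Build R V
  dotC dot_gt0 dotDr dotZr (fun=> erefl).

HB.end.

Section unordered_sum.
Context {R : realType} {I : choiceType}.

Lemma partial_sumE (U : zmodType) (x : I -> U) (J : {fset I}) :
  partial_sum x J = \sum_(k <- J) x k.
Proof. by rewrite /partial_sum big_seq_fsetE. Qed.

Lemma sum_fsubset (U : zmodType) (x : I -> U) (A B : {fset I}) : (A `<=` B)%fset ->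
  \sum_(k <- B) x k = \sum_(k <- A) x k + \sum_(k <- B | k \notin A) x k.
Proof.
move=> AB; rewrite (bigID (fun k => k \in A)) /=; congr (_ + _).
rewrite -big_filter; apply: perm_big; apply: uniq_perm.
- by rewrite filter_uniq.
- exact: fset_uniq.
- move=> k; rewrite mem_filter; case kA: (k \in A) => //=.
  exact: (fsubsetP AB).
Qed.

Lemma ler_sum_fsubset (a : I -> R) (A B : {fset I}) : (forall k, 0 <= a k) ->
  (A `<=` B)%fset -> \sum_(k <- A) a k <= \sum_(k <- B) a k.
Proof. by move=> a0 /(sum_fsubset a) ->; rewrite lerDl sumr_ge0. Qed.

Lemma esum_fset_ge (a : I -> R) (J : {fset I}) : (forall k, 0 <= a k) ->
  ((\sum_(k <- J) a k)%:E <= \esum_(k in [set: I]) (a k)%:E)%E.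
Proof.
move=> a0; apply: esum_ge; exists [set` J]; first by split.
by rewrite -fsbig_seq // sumEFin.
Qed.

Lemma esum_fset_le (a : I -> R) (C : R) :
  (forall J : {fset I}, \sum_(k <- J) a k <= C) ->
  (\esum_(k in [set: I]) (a k)%:E <= C%:E)%E.
Proof.
move=> aC; apply: ge_ereal_sup => _ [A [finA _] <-].
by rewrite fsbig_finite //= sumEFin lee_fin.
Qed.

Lemma esum_fin_bounded (a : I -> R) : (forall k, 0 <= a k) ->
  (\esum_(k in [set: I]) (a k)%:E < +oo)%E <->
  exists C, forall J : {fset I}, \sum_(k <- J) a k <= C.
Proof.
move=> a0; split=> [oo|[C aC]]; last first.
  by apply: le_lt_trans (esum_fset_le aC) _; rewrite ltry.
exists (fine (\esum_(k in [set: I]) (a k)%:E)) => J.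
rewrite -lee_fin fineK ?esum_fset_ge // ge0_fin_numE //.
by apply: esum_ge0 => k _; rewrite lee_fin.
Qed.

Lemma partial_sum_cvg_esum (a : I -> R) : (forall k, 0 <= a k) ->
  (\esum_(k in [set: I]) (a k)%:E < +oo)%E ->
  partial_sum a @ totally --> fine (\esum_(k in [set: I]) (a k)%:E).
Proof.
move=> a0 aoo; set S := fine _.
have SE : S%:E = \esum_(k in [set: I]) (a k)%:E.
  rewrite fineK // ge0_fin_numE //.
  by apply: esum_ge0 => k _; rewrite lee_fin.
have leS (J : {fset I}) : \sum_(k <- J) a k <= S.
  by rewrite -lee_fin SE esum_fset_ge.
apply/cvgrPdist_lt => e e0.
have [A Ae] : exists A : {fset I}, S - e < \sum_(k <- A) a k.
  apply: contrapT => /forallNP nA.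
  suff : S <= S - e by lra.
  rewrite -lee_fin SE; apply: esum_fset_le => J; rewrite leNgt; exact/negP/nA.
exists A => // B /= AB; rewrite partial_sumE.
rewrite ger0_norm ?subr_ge0 //.
by have := ler_sum_fsubset a0 AB; lra.
Qed.

Lemma partial_sum_cauchy {U : pseudoMetricNormedZmodType R} (x : I -> U) :
  (\esum_(k in [set: I]) `|x k|%:E < +oo)%E ->
  cauchy (partial_sum x @ totally).
Proof.
move=> xoo; apply/cauchyP => e e0.
have /cvgrPdist_lt/(_ _ e0) := @partial_sum_cvg_esum (fun k => `|x k|) (fun=> normr_ge0 _) xoo.
set S := fine _ => -[A _ Ae]; exists (partial_sum x A).
exists A => // B /= AB; rewrite -ball_normE /= !partial_sumE.
rewrite (sum_fsubset x AB) opprD addrA subrr sub0r normrN.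
apply: le_lt_trans (ler_norm_sum _ _ _) _.
have hA := Ae A (fsubset_refl A); rewrite partial_sumE in hA.
have hB : \sum_(k <- B) `|x k| <= S.
  rewrite -lee_fin fineK ?esum_fset_ge // ge0_fin_numE //.
  by apply: esum_ge0 => k _; rewrite lee_fin.
have := sum_fsubset (fun k => `|x k|) AB => E.
move: hA; rewrite ger0_norm; first by lra.
by rewrite subr_ge0; apply: le_trans hB; apply: ler_sum_fsubset.
Qed.

Lemma eq_partial_sum_cvg {U : pseudoMetricNormedZmodType R} (x y : I -> U) (a : U) :
  x =1 y -> partial_sum x @ totally --> a -> partial_sum y @ totally --> a.
Proof. by move=> /funext ->. Qed.

Lemma partial_sum_cvgD {U : pseudoMetricNormedZmodType R} (x y : I -> U) (a b : U) :
  partial_sum x @ totally --> a -> partial_sum y @ totally --> b ->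
  partial_sum (fun k => x k + y k) @ totally --> a + b.
Proof.
move=> xa yb.
have -> : partial_sum (fun k => x k + y k) = partial_sum x + partial_sum y.
  by apply/funext => J; rewrite fctE /partial_sum big_split.
exact: cvgD.
Qed.

Lemma partial_sum_cvg_map {U V : pseudoMetricNormedZmodType R}
    (h : {additive U -> V}) C (x : I -> U) (a : U) :
  (forall u, `|h u| <= C * `|u|) -> partial_sum x @ totally --> a ->
  partial_sum (h \o x) @ totally --> h a.
Proof.
move=> hC xa; have -> : partial_sum (h \o x) = h \o partial_sum x.
  by apply/funext => J; rewrite /partial_sum /= raddf_sum.
by apply: continuous_cvg => //; exact: (lipschitz_additive_continuous hC).
Qed.

End unordered_sum.

Section quat_mul.
Variable R : realType.
Definition qmull (a x : quat R) := a * x.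
Definition qmulr (a x : quat R) := x * a.
Lemma qmull_is_zmod a : zmod_morphism (qmull a).
Proof. by move=> x y; rewrite /qmull mulrBr. Qed.
Lemma qmulr_is_zmod a : zmod_morphism (qmulr a).
Proof. by move=> x y; rewrite /qmulr mulrBl. Qed.
HB.instance Definition _ a := GRing.isZmodMorphism.Build _ _ (qmull a) (qmull_is_zmod a).
HB.instance Definition _ a := GRing.isZmodMorphism.Build _ _ (qmulr a) (qmulr_is_zmod a).
End quat_mul.

Definition square_summable {R : realType} {I : choiceType} : {pred I -> quat R} :=
  fun q => `[< (\esum_(k in [set: I]) (`|q k| ^+ 2)%:E < +oo)%E >].

Lemma square_summableP {R : realType} {I : choiceType} (q : I -> quat R) :
  q \in square_summable <->
  exists C, forall J : {fset I}, \sum_(k <- J) `|q k| ^+ 2 <= C.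
Proof.
rewrite -esum_fin_bounded; last by move=> k; exact: sqr_ge0.
by split=> /asboolP.
Qed.

Lemma square_summable_zmod {R : realType} {I : choiceType} :
  zmod_closed (@square_summable R I).
Proof.
split; first by apply/square_summableP; exists 0 => J;
  rewrite big1 // => k _; rewrite normr0 expr0n.
move=> p q /square_summableP[C hC] /square_summableP[D hD].
apply/square_summableP; exists ((C + C) + (D + D)) => J.
apply: le_trans (lerD (lerD (hC J) (hC J)) (lerD (hD J) (hD J))).
rewrite -!big_split /=; apply: ler_sum => k _.
have : `|(p - q) k| ^+ 2 <= (`|p k| + `|q k|) ^+ 2.
  by rewrite ler_pXn2r ?nnegrE ?addr_ge0 //; exact: ler_normB.
move=> /le_trans; apply.
by have := sqr_ge0 (`|p k| - `|q k|); nra.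
Qed.

HB.instance Definition _ (R : realType) (I : choiceType) :=
  GRing.isZmodClosed.Build (I -> quat R) square_summable square_summable_zmod.

Record ell2 (R : realType) (I : choiceType) := Ell2 {
  ell2_fun :> I -> quat R;
  ell2P : ell2_fun \in square_summable
}.

Section ell2.
Variables (R : realType) (I : choiceType).
Local Notation L := (ell2 R I).

HB.instance Definition _ := [isSub of L for @ell2_fun R I].
HB.instance Definition _ := [Choice of L by <:].
HB.instance Definition _ := [SubChoice_isSubZmodule of L by <:].

Implicit Types (p q : L) (a : quat R).

Lemma ell2_ext p q : p =1 q -> p = q.
Proof. by move=> pq; apply/val_inj/funext. Qed.

Lemma ell2DE p q k : (p + q) k = p k + q k. Proof. by []. Qed.
Lemma ell2BE p q k : (p - q) k = p k - q k. Proof. by []. Qed.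
Lemma ell20E k : (0 : L) k = 0. Proof. by []. Qed.

Lemma ell2_bounded p :
  exists C, forall J : {fset I}, \sum_(k <- J) `|p k| ^+ 2 <= C.
Proof. by apply/square_summableP; exact: ell2P. Qed.

Lemma ell2_scale_subproof p a : (fun k => p k * a) \in square_summable.
Proof.
have [C hC] := ell2_bounded p; apply/square_summableP.
exists (C * `|a| ^+ 2) => J; apply: le_trans (ler_wpM2r _ (hC J)) => //.
by rewrite big_distrl /=; apply: ler_sum => k _; rewrite qnormM exprMn.
Qed.
Definition ell2_scale p a : L := Ell2 (ell2_scale_subproof p a).

Lemma ell2_scaleA p a b : ell2_scale (ell2_scale p a) b = ell2_scale p (a * b).
Proof. by apply: ell2_ext => k /=; rewrite mulrA. Qed.
Lemma ell2_scale1 p : ell2_scale p 1 = p.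
Proof. by apply: ell2_ext => k /=; rewrite mulr1. Qed.
Lemma ell2_scaleDl p q a :
  ell2_scale (p + q) a = ell2_scale p a + ell2_scale q a.
Proof. by apply: ell2_ext => k; rewrite ell2DE /= -mulrDl. Qed.
Lemma ell2_scaleDr p a b :
  ell2_scale p (a + b) = ell2_scale p a + ell2_scale p b.
Proof. by apply: ell2_ext => k; rewrite ell2DE /= -mulrDr. Qed.
HB.instance Definition _ := Zmodule_isQuatRModule.Build R L
  ell2_scaleA ell2_scale1 ell2_scaleDl ell2_scaleDr.

Lemma ell2_rscaleE p a k : (p *> a) k = p k * a. Proof. by []. Qed.

Definition ell2_dot p q : quat R :=
  lim (partial_sum (fun k => qconj (p k) * q k) @ totally).

Lemma ell2_dot_cvg p q :
  partial_sum (fun k => qconj (p k) * q k) @ totally --> ell2_dot p q.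
Proof.
apply: cauchy_cvg; apply: partial_sum_cauchy.
apply/esum_fin_bounded => [//|].
have [C hC] := ell2_bounded p; have [D hD] := ell2_bounded q.
exists (C + D) => J; apply: le_trans (lerD (hC J) (hD J)).
rewrite -big_split /=; apply: ler_sum => k _.
rewrite qnormM qnorm_conj.
have := sqr_ge0 (`|p k| - `|q k|); have := sqr_ge0 (`|p k| + `|q k|); nra.
Qed.

Lemma ell2_dotP p q l :
  partial_sum (fun k => qconj (p k) * q k) @ totally --> l -> ell2_dot p q = l.
Proof. exact: norm_cvg_lim. Qed.

Lemma ell2_dotC p q : qconj (ell2_dot p q) = ell2_dot q p.
Proof.
apply/esym/ell2_dotP.
have h1 (u : quat R) : `|qconj u| <= 1 * `|u| by rewrite qnorm_conj mul1r.
have := partial_sum_cvg_map h1 (@ell2_dot_cvg p q).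
apply: eq_partial_sum_cvg => k; by rewrite /= qconjM qconjK.
Qed.

Lemma ell2_dotDr p q r : ell2_dot p (q + r) = ell2_dot p q + ell2_dot p r.
Proof.
apply: ell2_dotP.
have := partial_sum_cvgD (@ell2_dot_cvg p q) (@ell2_dot_cvg p r).
apply: eq_partial_sum_cvg => k; by rewrite ell2DE mulrDr.
Qed.

Lemma ell2_dotZr p q a : ell2_dot p (q *> a) = ell2_dot p q * a.
Proof.
apply: ell2_dotP.
have h1 (u : quat R) : `|qmulr a u| <= `|a| * `|u| by rewrite qnormM mulrC.
have := partial_sum_cvg_map h1 (@ell2_dot_cvg p q).
apply: eq_partial_sum_cvg => k; by rewrite /= /qmulr mulrA.
Qed.

Lemma ell2_dot_re p :
  qre (ell2_dot p p) = fine (\esum_(k in [set: I]) (`|p k| ^+ 2)%:E).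
Proof.
have h1 (u : quat R) : `|qre u : R^o| <= 1 * `|u| by rewrite mul1r qre_le.
have := partial_sum_cvg_map (V := R) h1 (@ell2_dot_cvg p p).
have -> : (@qre R \o fun k => qconj (p k) * p k) = (fun k => `|p k| ^+ 2).
  apply/funext => k; transitivity (qre (qconj (p k) * p k)) => //.
  by rewrite qmul_conj_self.
have := @partial_sum_cvg_esum R I (fun k => `|p k| ^+ 2) (fun=> sqr_ge0 _).
have /asboolP poo := ell2P p => /(_ poo) c1 c2.
by rewrite -(norm_cvg_lim c2) (norm_cvg_lim c1).
Qed.

Lemma ell2_sum_le_dot p (J : {fset I}) :
  \sum_(k <- J) `|p k| ^+ 2 <= qre (ell2_dot p p).
Proof.
rewrite ell2_dot_re -lee_fin fineK; first by apply: esum_fset_ge => k; exact: sqr_ge0.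
rewrite ge0_fin_numE; first exact/asboolP/ell2P.
by apply: esum_ge0 => k _; rewrite lee_fin sqr_ge0.
Qed.

Lemma ell2_dot_le p C :
  (forall J : {fset I}, \sum_(k <- J) `|p k| ^+ 2 <= C) ->
  qre (ell2_dot p p) <= C.
Proof.
move=> hC; rewrite ell2_dot_re -lee_fin fineK; first exact: esum_fset_le.
rewrite ge0_fin_numE; first exact/asboolP/ell2P.
by apply: esum_ge0 => k _; rewrite lee_fin sqr_ge0.
Qed.

Lemma ell2_dot_gt0 p : p != 0 -> 0 < qre (ell2_dot p p).
Proof.
move=> p0; have [k pk] : exists k, p k != 0.
  apply: contrapT => /forallNP h; move/eqP: p0; apply; apply: ell2_ext => k.
  by have /negP/negPn/eqP := h k.
apply: lt_le_trans (ell2_sum_le_dot p [fset k]%fset).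
by rewrite big_seq_fset1 exprn_gt0 // normr_gt0.
Qed.

HB.instance Definition _ := QuatRModule_hasDot.Build R L
  ell2_dotC ell2_dot_gt0 ell2_dotDr ell2_dotZr.

Lemma ell2_dotE p q : qdot p q = ell2_dot p q. Proof. by []. Qed.

Lemma ell2_norm_sqr p : `|p| ^+ 2 = qre (ell2_dot p p).
Proof.
rewrite qdot_norm sqr_sqrtr // ell2_dotE.
by apply: le_trans (ell2_sum_le_dot p fset0); rewrite big_seq_fset0.
Qed.

Lemma ell2_coord_le p k : `|p k| <= `|p|.
Proof.
rewrite -(@ler_pXn2r _ 2) ?nnegrE // ell2_norm_sqr.
by apply: le_trans (ell2_sum_le_dot p [fset k]%fset); rewrite big_seq_fset1.
Qed.

Definition ell2_coord k p : quat R := p k.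
Lemma ell2_coord_is_zmod k : zmod_morphism (ell2_coord k). Proof. by []. Qed.
HB.instance Definition _ k :=
  GRing.isZmodMorphism.Build _ _ (ell2_coord k) (ell2_coord_is_zmod k).

Lemma ell2_complete (F : set_system L) : ProperFilter F -> cauchy F -> cvg F.
Proof.
move=> FF Fc.
have cc k : cvg (ell2_coord k @ F).
  apply: cauchy_cvg; apply: (@lipschitz_cauchy _ _ _ _ 1) => // p.
  by rewrite mul1r ell2_coord_le.
pose l : I -> quat R := fun k => lim (ell2_coord k @ F).
have cd (p : L) k : (fun q : L => `|q k - p k| ^+ 2) @ F --> `|l k - p k| ^+ 2.
  have ck : (fun q : L => q k - p k) @ F --> l k - p k.
    by apply: cvgB; [exact: cc|exact: cvg_cst].
  rewrite expr2; under eq_fun do rewrite expr2.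
  by apply: cvgM; apply: cvg_norm.
have lP e : 0 < e -> exists2 c : L, F (ball c e) & forall p : L, ball c e p ->
    forall J : {fset I}, \sum_(k <- J) `|l k - p k| ^+ 2 <= (e + e) ^+ 2.
  move=> e0; have /cauchyP/(_ _ e0)[c Fce] := Fc.
  exists c => // p; rewrite -ball_normE /= => cp J.
  have cv : (fun q : L => \sum_(k <- J) `|q k - p k| ^+ 2) @ F -->
      \sum_(k <- J) `|l k - p k| ^+ 2.
    elim: (J : seq I) => [|k s IH].
      by under eq_fun do rewrite big_nil; rewrite big_nil; exact: cvg_cst.
    under eq_fun do rewrite big_cons; rewrite big_cons.
    exact: cvgD (cd p k) IH.
  apply: (cvgr_to_le cv); near=> q.
  apply: le_trans (ell2_sum_le_dot (q - p) J) _.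
  have cq : `|c - q| < e.
    have : ball c e q by near: q.
    by rewrite -ball_normE.
  rewrite -ell2_norm_sqr ler_pXn2r ?nnegrE // ?addr_ge0 ?ltW //.
  by have := ler_distD c q p; rewrite (distrC q c); lra.
have lss : l \in square_summable.
  have [c Fc1 /(_ c (ballxx c ltr01)) lc] := lP 1 ltr01.
  have hc : (fun k => l k - c k) \in square_summable.
    by apply/square_summableP; exists ((1 + 1) ^+ 2); exact: lc.
  have -> : l = (fun k => l k - c k) + (c : I -> quat R).
    by apply/funext => k; rewrite fctE subrK.
  exact: rpredD hc (ell2P c).
apply/cvg_ex; exists (Ell2 lss); apply/cvgrPdist_lt => e e0.
have e30 : 0 < e / 3 by lra.
have [c Fce hc] := lP _ e30; apply: filterS Fce => p /hc hp.
have : `|Ell2 lss - p| <= e / 3 + e / 3.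
  rewrite -(@ler_pXn2r _ 2) ?nnegrE ?addr_ge0 ?divr_ge0 // ?(ltW e0) //.
  rewrite ell2_norm_sqr; apply: ell2_dot_le => J; exact: hp.
lra.
Unshelve. all: by end_near. Qed.

HB.instance Definition _ := QuatPreHilbert_isComplete.Build R L ell2_complete.

End ell2.

Section ell2_basis.
Variables (R : realType) (I : choiceType).

Lemma ell2_basis_subproof (k : I) :
  (fun j => if j == k then 1 else 0 : quat R) \in square_summable.
Proof.
apply/square_summableP; exists (`|1 : quat R| ^+ 2) => J.
case kJ : (k \in J); last first.
  rewrite big_seq big1 ?sqr_ge0 // => j jJ.
  by case: eqP => [jk|_]; rewrite ?normr0 ?expr0n //; rewrite jk kJ in jJ.
rewrite (big_fsetD1 k) //= eqxx big_seq big1 ?addr0 // => j.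
by rewrite !inE => /andP[/negPf-> _]; rewrite normr0 expr0n.
Qed.
Definition ell2_basis (k : I) : ell2 R I := Ell2 (ell2_basis_subproof k).
End ell2_basis.

Definition right_linear {R : realType} {U V : quatRmodType R} (T : U -> V) :=
  forall x y (p q : quat R), T (x *> p + y *> q) = T x *> p + T y *> q.

Definition bounded_op {R : realType} {U V : quatHilbertType R} (T : U -> V) :=
  exists C : R, forall x, `|T x| <= C * `|x|.

Definition bounded_rlinear {R : realType} {U V : quatHilbertType R}
  (T : U -> V) := right_linear T /\ bounded_op T.

(* The default value 0 is never used when T is bounded right linear, see
   adjointP below. *)
Definition adjoint {R : realType} {U V : quatHilbertType R} (T : U -> V)
    (y : V) : U :=
  xget 0 [set z | forall x, qdot (T x) y = qdot x z].

Section quat_hilbert_theory.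
Context {R : realType}.

Section prehilbert.
Context {V : quatPreHilbertType R}.
Implicit Types x y z : V.

Lemma rscaler0 x : x *> (0 : quat R) = 0.
Proof. by apply: (addrI (x *> 0)); rewrite -rscaleDr !addr0. Qed.

Lemma qdotr0 x : qdot x 0 = 0.
Proof. by apply: (addrI (qdot x 0)); rewrite -qdotDr !addr0. Qed.

Lemma qdotNr x y : qdot x (- y) = - qdot x y.
Proof. by apply: (addrI (qdot x y)); rewrite -qdotDr !subrr qdotr0. Qed.

Lemma qdotDl x y z : qdot (x + y) z = qdot x z + qdot y z.
Proof. by rewrite -qdotC qdotDr raddfD /= !qdotC. Qed.

Lemma qdotNl x y : qdot (- x) y = - qdot x y.
Proof. by rewrite -qdotC qdotNr raddfN /= qdotC. Qed.

Lemma qdotZl x y a : qdot (x *> a) y = qconj a * qdot x y.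
Proof. by rewrite -qdotC qdotZr qconjM qdotC. Qed.

Lemma re_qdotC x y : qre (qdot y x) = qre (qdot x y).
Proof. by rewrite -qdotC. Qed.

Lemma qdot_norm_sqr x : `|x| ^+ 2 = qre (qdot x x).
Proof.
rewrite qdot_norm sqr_sqrtr //.
by have [->|/qdot_gt0/ltW//] := eqVneq x 0; rewrite qdotr0.
Qed.

Lemma norm_sqrD x y : `|x + y| ^+ 2 = `|x| ^+ 2 + qre (qdot x y) *+ 2 + `|y| ^+ 2.
Proof.
rewrite !qdot_norm_sqr qdotDl !qdotDr !raddfD /= (re_qdotC x y).
by rewrite mulr2n !addrA.
Qed.

Lemma norm_rscale x a : `|x *> a| = `|x| * `|a|.
Proof.
apply/eqP; rewrite -(@eqrXn2 _ 2) ?mulr_ge0 //; apply/eqP.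
rewrite exprMn !qdot_norm_sqr qdotZl qdotZr -(qdotC x x).
have := qdotC x x; case: (qdot x x) => b c d e [hc hd he].
have -> : c = 0 by lra. have -> : d = 0 by lra. have -> : e = 0 by lra.
by rewrite qnorm_sqr /=; ring.
Qed.

Lemma re_qdot_le x y : qre (qdot x y) <= `|x| * `|y|.
Proof.
have : `|x + y| ^+ 2 <= (`|x| + `|y|) ^+ 2.
  by rewrite ler_pXn2r ?nnegrE ?addr_ge0 // ler_normD.
rewrite norm_sqrD sqrrD; lra.
Qed.

Lemma cauchy_schwarz x y : `|qdot x y| <= `|x| * `|y|.
Proof.
have [->|a0] := eqVneq (qdot x y) 0; first by rewrite normr0 mulr_ge0.
have := re_qdot_le x (y *> qconj (qdot x y)).
rewrite qdotZr norm_rscale qnorm_conj mulrA.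
have -> : qre (qdot x y * qconj (qdot x y)) = `|qdot x y| * `|qdot x y|.
  by rewrite -expr2 qnorm_sqr /=; ring.
by rewrite ler_pM2r // normr_gt0.
Qed.

End prehilbert.

Section riesz.
Context {V : quatHilbertType R}.
Variables (phi : V -> quat R) (C : R).
Hypothesis phiD : forall x y, phi (x + y) = phi x + phi y.
Hypothesis phiZ : forall x a, phi (x *> a) = phi x * a.
Hypothesis phiC : forall x, `|phi x| <= C * `|x|.

Let J (x : V) : R := `|x| ^+ 2 - qre (phi x) *+ 2.

Let re_phi_le x : `|qre (phi x)| <= C * `|x|.
Proof. exact: le_trans (qre_le _) (phiC x). Qed.

Let phiN x : phi (- x) = - phi x.
Proof.
apply: (addrI (phi x)); rewrite -phiD !subrr.
by have := phiZ 0 0; rewrite rscaler0 mulr0.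
Qed.

Let rq (t : R) : quat R := Quat t 0 0 0.

Let JD x y t : J (x + y *> rq t) =
  J x + t * (qre (qdot x y) - qre (phi y)) *+ 2 + t ^+ 2 * `|y| ^+ 2.
Proof.
rewrite /J norm_sqrD phiD phiZ qdotZr norm_rscale exprMn.
by rewrite (qnorm_sqr (rq t)) raddfD /=; ring.
Qed.

Let J_has_inf : has_inf (range J).
Proof.
split; first by exists (J 0), 0.
exists (- C ^+ 2) => _ [x _ <-]; rewrite /J.
have := re_phi_le x; rewrite ler_norml => /andP[_ h].
by have := sqr_ge0 (`|x| - C); nra.
Qed.

Let m := inf (range J).

Let m_le x : m <= J x.
Proof. by apply: ge_inf; [case: J_has_inf|exists x]. Qed.

Let J_par x y : `|x - y| ^+ 2 <= (J x + J y - m *+ 2) *+ 2.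
Proof.
have h := m_le (x *> rq (1 / 2) + y *> rq (1 / 2)).
have e1 : J (x *> rq (1 / 2) + y *> rq (1 / 2)) =
   (`|x| ^+ 2 + qre (qdot x y) *+ 2 + `|y| ^+ 2) / 4 - qre (phi x) - qre (phi y).
  rewrite /J norm_sqrD phiD !phiZ qdotZl qdotZr !norm_rscale !exprMn.
  by rewrite (qnorm_sqr (rq _)) raddfD /=; field.
have e2 : `|x - y| ^+ 2 = `|x| ^+ 2 - qre (qdot x y) *+ 2 + `|y| ^+ 2.
  by rewrite norm_sqrD qdotNr raddfN /= normrN mulNrn.
by move: h; rewrite e1 e2 /J; lra.
Qed.

Let F : set_system V :=
  filter_from [set e : R | 0 < e] (fun e => [set x | J x < m + e]).

Let F_proper : ProperFilter F.
Proof.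
apply: filter_from_proper; last first.
  move=> e e0; have [_ [x _ <-] xe] := inf_adherent e0 J_has_inf.
  by exists x.
apply: filter_from_filter; first by exists 1 => /=.
move=> e d /= e0 d0; exists (Num.min e d); first by rewrite lt_min e0 d0.
by move=> x /=; rewrite -ltrBlDl lt_min !ltrBlDl => /andP[].
Qed.

Let F_cauchy : cauchy F.
Proof.
have FP := F_proper; apply/cauchyP => e e0.
have d0 : 0 < e ^+ 2 / 4 by rewrite divr_gt0 // exprn_gt0.
have [_ [x _ <-] xe] := inf_adherent d0 J_has_inf.
exists x; exists (e ^+ 2 / 4) => // y /= ye; rewrite -ball_normE /=.
rewrite -(@ltr_pXn2r _ 2) ?nnegrE // ?(ltW e0) //.
apply: le_lt_trans (J_par x y) _.
by move: xe ye; rewrite -/m; lra.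
Qed.

Lemma riesz : exists z, forall x, qdot z x = phi x.
Proof.
have FP := F_proper.
have /cvg_ex[z zF] := @quat_cauchy_cvg _ _ _ F_proper F_cauchy.
have Jz : J z <= m.
  apply/ler_addgt0Pl => e e0.
  pose K := `|z| *+ 2 + 3 + C *+ 2.
  pose d := Num.min 1 (e / 2 / (`|K| + 1)).
  have K1 : 0 < `|K| + 1 by rewrite ltr_wpDl.
  have d0 : 0 < d by rewrite lt_min ltr01 /= !divr_gt0.
  have e20 : 0 < e / 2 by lra.
  have [x [/= xz xJ]] : exists x, `|z - x| < d /\ J x < m + e / 2.
    near F => x; exists x; split; near: x.
      by move/fcvgrPdist_lt: zF; apply.
    by exists (e / 2).
  have d1 : d <= 1 by rewrite ge_min lexx.
  have dK : d * (`|K| + 1) <= e / 2.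
    by rewrite -ler_pdivlMr // ge_min lexx orbT.
  have e1 : J z = J x + (qre (qdot x (z - x)) - qre (phi (z - x))) *+ 2
      + `|z - x| ^+ 2.
    have := JD x (z - x) 1; rewrite (_ : rq 1 = 1) // rscale1 addrC subrK.
    by move=> ->; rewrite expr1n !mul1r.
  have h1 := re_qdot_le x (z - x).
  have h2 := re_phi_le (z - x); rewrite ler_norml in h2.
  have h3 : `|x| <= `|z| + `|z - x|.
    by rewrite -{1}(subKr z x); exact: ler_normB.
  have KK := ler_norm K.
  move/andP: h2 => [h2 _]; rewrite e1.
  have s0 := normr_ge0 (z - x); have x0 := normr_ge0 x.
  set s := `|z - x| in xz h1 h2 h3 s0 *.
  have hs : (qre (qdot x (z - x)) - qre (phi (z - x))) *+ 2 + s ^+ 2 <= s * K.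
    have : `|x| * s <= (`|z| + s) * s by rewrite ler_wpM2r.
    have : s * s <= s * 1 by rewrite ler_wpM2l //; lra.
    by rewrite /K; lra.
  have : s * K <= d * (`|K| + 1).
    apply: le_trans (_ : s * (`|K| + 1) <= _); last by rewrite ler_wpM2r // ltW.
    by rewrite ler_wpM2l //; lra.
  lra.
have crit x : qre (qdot z x) = qre (phi x).
  set b := qre _; set c := qre _.
  have h t : 0 <= t * (b - c) *+ 2 + t ^+ 2 * `|x| ^+ 2.
    have := le_trans Jz (m_le (z + x *> rq t)); rewrite JD -/b -/c; lra.
  apply/eqP; rewrite -subr_eq0 -sqrf_eq0 eq_le sqr_ge0 andbT.
  have N0 : 0 < `|x| ^+ 2 + 1 by rewrite ltr_wpDl // sqr_ge0.
  have := h (- (b - c) / (`|x| ^+ 2 + 1)).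
  set N := `|x| ^+ 2 in N0 *; set w := b - c => h1.
  have e1 : - w / (N + 1) * w *+ 2 + (- w / (N + 1)) ^+ 2 * N =
     - (w ^+ 2 * (N + 2) / (N + 1) ^+ 2) by field; lra.
  move: h1; rewrite e1 oppr_ge0 pmulr_lle0 ?invr_gt0 ?exprn_gt0 //.
  by rewrite pmulr_lle0 //; lra.
exists z => x; apply/eqP; rewrite -subr_eq0 -normr_eq0 -sqrf_eq0.
set u := qdot z x - phi x.
have : qre (u * qconj u) = 0.
  have := crit (x *> qconj u); rewrite qdotZr phiZ /u mulrBl raddfB /= => ->.
  by rewrite subrr.
by move=> hu; apply/eqP; rewrite qnorm_sqr -hu /=; ring.
Unshelve. all: by end_near. Qed.

End riesz.

Lemma adjointP {U V : quatHilbertType R} (T : U -> V) : bounded_rlinear T ->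
  forall x y, qdot (T x) y = qdot x (adjoint T y).
Proof.
move=> [Tlin [C TC]] x y; move: x.
rewrite /adjoint; case: xgetP => [z _ //|nz].
have TD a b : T (a + b) = T a + T b.
  by have := Tlin a b 1 1; rewrite !rscale1.
have TZ a q : T (a *> q) = T a *> q.
  by have := Tlin a 0 q 0; rewrite !rscaler0 !addr0.
have [||c|z hz] := @riesz U (fun x => qdot y (T x)) (`|y| * C).
- by move=> a b; rewrite TD qdotDr.
- by move=> a q; rewrite TZ qdotZr.
- apply: le_trans (cauchy_schwarz _ _) _.
  by rewrite -mulrA ler_wpM2l.
by exfalso; apply: (nz z) => x /=; rewrite -qdotC -hz qdotC.
Qed.

End quat_hilbert_theory.

Definition separable (T : topologicalType) :=
  exists D : set T, countable D /\ dense D.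

Section frames.
Context {R : realType} {I : choiceType} {H : quatHilbertType R}.
Implicit Types (f g : I -> H) (K : H -> H).

Definition frame_sum f (x : H) : \bar R :=
  \esum_(k in [set: I]) (`|qdot x (f k)| ^+ 2)%:E.

Definition bessel f := exists B : R, 0 < B /\
  forall x, (frame_sum f x <= (B * `|x| ^+ 2)%:E)%E.

Definition kframe K f := exists A B : R, [/\ 0 < A, 0 < B &
  forall x, ((A * `|adjoint K x| ^+ 2)%:E <= frame_sum f x)%E /\
            (frame_sum f x <= (B * `|x| ^+ 2)%:E)%E].

(* Vector sums over I are unordered: limits along the net of finite subsets. *)
Definition kdual K f g := bessel g /\
  forall x, partial_sum (fun k => f k *> qdot (g k) x) @ totally --> K x.

Definition synthesis f (c : ell2 R I) : H :=
  lim (partial_sum (fun k => f k *> c k) @ totally).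

End frames.

(* Main.v *)
Require Import Defs.
From HB Require Import structures.
From mathcomp Require Import all_boot all_order all_algebra finmap.
From mathcomp Require Import ring lra.
From mathcomp Require Import boolp classical_sets reals ereal.
From mathcomp Require Import summability normedtype.

(** If g is a K-dual of f, take M to be the synthesis operator of g.  In both
    directions M^* x is the family <M e_k, x> = <g_k, x>, so that T_F M^* = K is
    the reconstruction formula; and g is Bessel because the frame sum of g at x
    is the squared norm of M^* x. *)

Set Implicit Arguments.
Unset Strict Implicit.
Unset Printing Implicit Defensive.

Import Order.TTheory GRing.Theory Num.Theory.
Import numFieldNormedType.Exports.

Local Open Scope classical_set_scope.
Local Open Scope ring_scope.

Section right_scaling.
Context {R : realType} {V : quatPreHilbertType R}.

(** A named map, so that right multiplication by a fixed scalar can carry the additive structure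
    [partial_sum_cvg_map] asks for. *)
Definition rscale_by (a : quat R) (x : V) : V := x *> a.

Lemma rscale_by_is_zmod a : zmod_morphism (rscale_by a).
Proof.
move=> x y; apply/eqP; rewrite -subr_eq opprK; apply/eqP.
by rewrite /rscale_by -rscaleDl subrK.
Qed.
HB.instance Definition _ a :=
  GRing.isZmodMorphism.Build V V (rscale_by a) (rscale_by_is_zmod a).

End right_scaling.

Lemma sum_fsetD {I : choiceType} {U : zmodType} (x : I -> U) (A B : {fset I}) :
  (A `<=` B)%fset ->
  \sum_(k <- (B `\` A)%fset) x k = \sum_(k <- B) x k - \sum_(k <- A) x k.
Proof.
move=> AB; rewrite (sum_fsubset x AB) addrC addKr -[RHS]big_filter.
apply: perm_big; apply: uniq_perm; rewrite ?filter_uniq ?fset_uniq // => k.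
by rewrite mem_filter in_fsetD.
Qed.

Section supported_at_a_point.
Context {R : realType} {I : choiceType}.

Lemma partial_sum_cvg1 {U : pseudoMetricNormedZmodType R} (x : I -> U) (k : I) :
  (forall j, j != k -> x j = 0) -> partial_sum x @ totally --> x k.
Proof.
move=> x0; apply/cvgrPdist_lt => e e0; exists [fset k]%fset => // B /= kB.
rewrite partial_sumE (big_fsetD1 k) /=; last by rewrite -fsub1set.
rewrite big_seq big1 ?addr0 ?subrr ?normr0 // => j.
by rewrite !inE => /andP[/x0].
Qed.

Lemma qdot_basis (k : I) (p : ell2 R I) : qdot (ell2_basis R k) p = p k.
Proof.
rewrite ell2_dotE; apply: ell2_dotP.
have -> : p k = qconj (ell2_basis R k k) * p k.
  rewrite /= eqxx; have -> : qconj (1 : quat R) = 1.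
    by congr Quat; rewrite oppr0.
  by rewrite mul1r.
apply: partial_sum_cvg1 => j /negPf jk /=.
by rewrite jk raddf0 mul0r.
Qed.

Lemma adjoint_coord {H : quatHilbertType R} (M : ell2 R I -> H) (x : H) (k : I) :
  bounded_rlinear M -> adjoint M x k = qdot (M (ell2_basis R k)) x.
Proof. by move=> Mb; rewrite adjointP // qdot_basis. Qed.

End supported_at_a_point.

(** With [z = adjoint T y], [|z|^2 = Re <T z, y> <= C |z| |y|]; divide by [|z|]. *)
Lemma adjoint_bounded {R : realType} {U V : quatHilbertType R} (T : U -> V)
    (C : R) : 0 <= C -> bounded_rlinear T -> (forall x, `|T x| <= C * `|x|) ->
  forall y, `|adjoint T y| <= C * `|y|.
Proof.
move=> C0 Tb TC y; set z := adjoint T y.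
have [z0|z0] := eqVneq `|z| 0; first by rewrite z0 mulr_ge0.
have zp : 0 < `|z| by rewrite lt_def z0 /=.
rewrite -(ler_pM2r zp) -expr2 qdot_norm_sqr {2}/z -adjointP //.
apply: le_trans (re_qdot_le _ _) _.
by rewrite mulrAC ler_wpM2r.
Qed.

Section synthesis.
Context {R : realType} {I : choiceType} {H : quatHilbertType R}.
Variables (f : I -> H) (B : R).
Hypothesis B0 : 0 < B.
Hypothesis fB : forall x, (frame_sum f x <= (B * `|x| ^+ 2)%:E)%E.
Implicit Types (c : ell2 R I) (J : seq I).

Lemma frame_sum_fset_le x (J : {fset I}) :
  \sum_(k <- J) `|qdot x (f k)| ^+ 2 <= B * `|x| ^+ 2.
Proof.
rewrite -lee_fin; apply: le_trans (fB x).
by apply: esum_fset_ge => k; exact: sqr_ge0.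
Qed.

Lemma qdot_sumr x c J :
  qdot x (\sum_(k <- J) f k *> c k) = \sum_(k <- J) qdot x (f k) * c k.
Proof.
elim: J => [|k J IH]; first by rewrite !big_nil qdotr0.
by rewrite !big_cons qdotDr qdotZr IH.
Qed.

(** Finite form of [|T_F|^2 <= B]. Expanding [|y|^2 = Re <y, y>] in its second argument gives the
    sum of the real parts of [<y, f_k> c_k]; each term is split into a Bessel term and a coefficient
    term. *)
Lemma synthesis_fset_le c (J : {fset I}) :
  `|\sum_(k <- J) f k *> c k| ^+ 2 <= B * \sum_(k <- J) `|c k| ^+ 2.
Proof.
set y := \sum_(k <- J) _.
(* The Bessel term equals one copy of [|y|^2], which is absorbed on the left. *)
suff h : `|y| ^+ 2 *+ 2 <= B^-1 * (B * `|y| ^+ 2) + B * \sum_(k <- J) `|c k| ^+ 2.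
  by move: h; rewrite mulKf ?gt_eqF //; lra.
have := frame_sum_fset_le y J; rewrite -(@ler_pM2l _ B^-1) ?invr_gt0 // => hy.
apply: le_trans (lerD hy (lexx _)).
rewrite qdot_norm_sqr {2}/y qdot_sumr raddf_sum /= -sumrMnl.
rewrite !big_distrr -big_split /=; apply: ler_sum => k _.
have := le_trans (ler_norm _) (qre_le (qdot y (f k) * c k)).
rewrite qnormM; set a := `|qdot y (f k)|; set b := `|c k| => /= h.
(* AM-GM: [2 a b <= a^2 / B + B b^2] *)
have -> : B^-1 * a ^+ 2 + B * b ^+ 2 = (a * b) *+ 2 + B^-1 * (a - B * b) ^+ 2.
  by field; rewrite gt_eqF.
have : 0 <= B^-1 * (a - B * b) ^+ 2 by rewrite pmulr_rge0 ?invr_gt0 ?sqr_ge0.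
by lra.
Qed.

(** By completeness: [synthesis_fset_le] on a difference of finite sets bounds the increment of the
    vector series by that of the convergent series of [|c_k|^2]. *)
Lemma synthesis_cvg c :
  partial_sum (fun k => f k *> c k) @ totally --> synthesis f c.
Proof.
apply: quat_cauchy_cvg; apply/cauchyP => e e0.
have /asboolP coo := ell2P c.
(* Two partial sums of [|c_k|^2] within this distance of [S] differ by less than [e^2 / B], and the
   factor [B] turns this into [e^2]. *)
have d0 : 0 < e ^+ 2 / B / 2 by rewrite !divr_gt0 // exprn_gt0.
have c2 k : 0 <= `|c k| ^+ 2 by exact: sqr_ge0.
have /cvgrPdist_lt/(_ _ d0) := partial_sum_cvg_esum c2 coo.
set S := fine _ => -[A _ Ae]; exists (partial_sum (fun k => f k *> c k) A).
exists A => // B' /= AB; rewrite -ball_normE /= !partial_sumE distrC.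
rewrite -sum_fsetD // -(@ltr_pXn2r _ 2) ?nnegrE ?(ltW e0) //.
apply: le_lt_trans (synthesis_fset_le _ _) _; rewrite sum_fsetD //.
rewrite mulrC -ltr_pdivlMr //.
have := Ae A (fsubset_refl A); have := Ae B' AB; rewrite !partial_sumE !ltr_norml.
lra.
Qed.

Lemma synthesisE c l :
  partial_sum (fun k => f k *> c k) @ totally --> l -> synthesis f c = l.
Proof. exact: norm_cvg_lim. Qed.

Lemma synthesis_right_linear : right_linear (synthesis f).
Proof.
move=> c d p q; apply: synthesisE.
have scale_le a (x : H) : `|rscale_by a x| <= `|a| * `|x|.
  by rewrite /rscale_by norm_rscale mulrC.
have := partial_sum_cvgD (partial_sum_cvg_map (scale_le p) (@synthesis_cvg c))
  (partial_sum_cvg_map (scale_le q) (@synthesis_cvg d)).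
apply: eq_partial_sum_cvg => k /=.
by rewrite /rscale_by rscaleDr !rscaleA.
Qed.

(** The finite bound passes to the limit by continuity of the norm. *)
Lemma synthesis_le c : `|synthesis f c| <= Num.sqrt B * `|c|.
Proof.
apply: (cvgr_to_le (cvg_norm (@synthesis_cvg c))); apply: nearW => J.
rewrite partial_sumE -(@ler_pXn2r _ 2) ?nnegrE ?mulr_ge0 ?sqrtr_ge0 //.
rewrite exprMn sqr_sqrtr ?(ltW B0) //.
apply: le_trans (synthesis_fset_le _ _) _.
by rewrite ler_wpM2l ?(ltW B0) // ell2_norm_sqr ell2_sum_le_dot.
Qed.

Lemma synthesis_bounded_rlinear : bounded_rlinear (synthesis f).
Proof.
by split; [exact: synthesis_right_linear|exists (Num.sqrt B); exact: synthesis_le].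
Qed.

Lemma synthesis_basis k : synthesis f (ell2_basis R k) = f k.
Proof.
(* Writing the limit as [f k *> 1] exhibits it as the only nonzero term of the series. *)
apply: synthesisE; rewrite -[X in _ --> X]rscale1.
have := @partial_sum_cvg1 R I H (fun j => f j *> ell2_basis R k j) k.
rewrite /= eqxx; apply=> j /negPf ->; exact: rscaler0.
Qed.

End synthesis.

(** The finite sums of [|<x, M e_k>|^2] are partial sums of [|M^* x|^2], and [M^*] obeys the same
    bound as [M]. *)
Lemma bounded_rlinear_bessel {R : realType} {I : choiceType}
    {H : quatHilbertType R} (M : ell2 R I -> H) :
  bounded_rlinear M -> bessel (fun k => M (ell2_basis R k)).
Proof.
move=> Mb; have [_ [C MC]] := Mb.
(* [bounded_op] does not fix the sign of [C]. *)
have MC' x : `|M x| <= `|C| * `|x|.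
  by apply: le_trans (MC x) _; rewrite ler_wpM2r // ler_norm.
(* The summand 1 keeps the Bessel bound positive when [C = 0]. *)
have C1 : 0 < `|C| ^+ 2 + 1 by rewrite ltr_wpDl // sqr_ge0.
exists (`|C| ^+ 2 + 1); split=> // x; apply: esum_fset_le => J.
apply: (@le_trans _ _ (`|adjoint M x| ^+ 2)).
  rewrite ell2_norm_sqr; apply: le_trans (ell2_sum_le_dot _ J).
  by apply: ler_sum => k _; rewrite adjoint_coord // -qdotC qnorm_conj.
apply: (@le_trans _ _ ((`|C| * `|x|) ^+ 2)).
  by rewrite ler_pXn2r ?nnegrE ?mulr_ge0 //; exact: adjoint_bounded.
by rewrite exprMn ler_wpM2r ?sqr_ge0 // lerDl.
Qed.

Theorem theorem3p8 (R : realType) (H : quatHilbertType R) (I : countType)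
    (K : H -> H) (f g : I -> H) :
  separable H ->
  bounded_rlinear K ->
  kframe K f ->
  (kdual K f g <->
   exists M : ell2 R I -> H,
     [/\ bounded_rlinear M,
         (forall x : H, synthesis f (adjoint M x) = K x) &
         (forall k : I, g k = M (ell2_basis R k))]).
Proof.
move=> _ _ [A [B [_ B0 fAB]]].
(* The series for [T_F (M^* x)] and the reconstruction series of [x] have the same terms. *)
have coordE M : bounded_rlinear M -> (forall k, g k = M (ell2_basis R k)) ->
    forall x, (fun k => f k *> adjoint M x k) = (fun k => f k *> qdot (g k) x).
  by move=> Mb gM x; apply/funext => k; rewrite adjoint_coord // gM.
split=> [[[D [D0 gD]] fgK]|[M [Mb MK gM]]].
  have Mb := synthesis_bounded_rlinear D0 gD.
  have gM k : g k = synthesis g (ell2_basis R k) by rewrite synthesis_basis.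
  exists (synthesis g); split=> // x.
  by apply: synthesisE; rewrite (coordE _ Mb gM).
split; first by rewrite (funext gM); exact: bounded_rlinear_bessel.
move=> x; rewrite -MK -(coordE _ Mb gM).
(* [MK] only identifies a [lim]; that the series converges to it comes from the upper bound of the
   K-frame [f]. *)
by apply: (synthesis_cvg B0) => y; have [] := fAB y.
Qed.
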